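(* Let $X$ be a real normed linear space and let $x,y\in X$ be nonzero vectors. Then $$\alpha_p[x,y]\leq K_{\geq 1}(p)\leq M_{\geq 1}(p)\quad\text{for } p\geq 1,$$ $$\alpha_p[x,y]\leq K_{<1}(p)\leq M_{[0,1)}(p)\quad\text{for } 0\leq p<1,$$ $$\alpha_p[x,y]\leq K_{<1}(p)\leq M_{<0}(p)\quad\text{for } p<0.$$ In addition, if $0\leq p<1$, then $$m_{[0,1)}(p)\leq k_{<1}(p)\leq \alpha_p[x,y].$$
   Context: For $p\in\mathbb{R}$ and nonzero $x,y\in X$, the $p$-angular distance is $\alpha_p[x,y]=\big\|\,\|x\|^{p-1}x-\|y\|^{p-1}y\,\big\|$. For fixed nonzero $x,y$, write $a=\min\{\|x\|,\|y\|\}$ and $b=\max\{\|x\|,\|y\|\}$, and define $K_{\geq 1}(p)=k_{<1}(p)=\|x\|^{p}+\|y\|^{p}-(\|x\|+\|y\|-\|x-y\|)\,a^{p-1}$, $K_{<1}(p)=\|x\|^{p}+\|y\|^{p}-(\|x\|+\|y\|-\|x-y\|)\,b^{p-1}$, $M_{\geq 1}(p)=p\,b^{p-1}\|x-y\|$, $M_{[0,1)}(p)=(2-p)\,b^{p-1}\|x-y\|$, $M_{<0}(p)=(2-p)\,\dfrac{a^{p}}{b}\,\|x-y\|$, $m_{[0,1)}(p)=p\,b^{p-1}\|x-y\|$. *)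

(* Defs.v *)
From HB Require Import structures.
From mathcomp Require Import all_boot all_order all_algebra.
From mathcomp Require Import all_classical all_reals all_analysis.

Set Implicit Arguments.
Unset Strict Implicit.
Unset Printing Implicit Defensive.

Import Order.TTheory GRing.Theory Num.Theory numFieldNormedType.Exports.
Local Open Scope ring_scope.

Definition alpha {R : realType} {X : normedModType R} (p : R) (x y : X) : R :=
  `| `|x| `^ (p - 1) *: x - `|y| `^ (p - 1) *: y |.

Definition min_norm {R : realType} {X : normedModType R} (x y : X) : R :=
  Num.min `|x| `|y|.

Definition max_norm {R : realType} {X : normedModType R} (x y : X) : R :=
  Num.max `|x| `|y|.

Definition K_ge1 {R : realType} {X : normedModType R} (x y : X) (p : R) : R :=
  `|x| `^ p + `|y| `^ p
    - (`|x| + `|y| - `|x - y|) * min_norm x y `^ (p - 1).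

(* The upper bound for [1 <= p] and the lower bound for [0 <= p < 1] are given
   by the same formula. *)
Definition k_lt1 {R : realType} {X : normedModType R} (x y : X) (p : R) : R :=
  K_ge1 x y p.

Definition K_lt1 {R : realType} {X : normedModType R} (x y : X) (p : R) : R :=
  `|x| `^ p + `|y| `^ p
    - (`|x| + `|y| - `|x - y|) * max_norm x y `^ (p - 1).

Definition M_ge1 {R : realType} {X : normedModType R} (x y : X) (p : R) : R :=
  p * max_norm x y `^ (p - 1) * `|x - y|.

Definition M_01 {R : realType} {X : normedModType R} (x y : X) (p : R) : R :=
  (2 - p) * max_norm x y `^ (p - 1) * `|x - y|.

Definition M_lt0 {R : realType} {X : normedModType R} (x y : X) (p : R) : R :=
  (2 - p) * (min_norm x y `^ p / max_norm x y) * `|x - y|.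

Definition m_01 {R : realType} {X : normedModType R} (x y : X) (p : R) : R :=
  p * max_norm x y `^ (p - 1) * `|x - y|.

(* Main.v *)
Require Import Defs.
From HB Require Import structures.
From mathcomp Require Import all_boot all_order all_algebra.
From mathcomp Require Import all_classical all_reals all_analysis.
From mathcomp Require Import ring lra.

Set Implicit Arguments.
Unset Strict Implicit.
Unset Printing Implicit Defensive.

Import Order.TTheory GRing.Theory Num.Theory numFieldNormedType.Exports.
Local Open Scope ring_scope.

(** Write [a <= b] for the two norms, [d] for [`|x - y|], and [A], [B] for the
    powers [a `^ (p - 1)], [b `^ (p - 1)]; everything is symmetric in [x] and
    [y], so let [a] be the norm of [x].

    The inequalities between [alpha] and the [K]'s are the triangle inequality
    applied to a difference of scaled vectors, split as
    [A x - B y = A (x - y) + (A - B) y] for [K_ge1] and [k_lt1], and as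
    [A x - B y = B (x - y) + (A - B) x] for [K_lt1] ([norm_scaleB_le], and
    [norm_scaleB_ge] for the lower bound).  The exponent [p - 1] enters only
    through its sign, which decides which of [A], [B] is the larger.

    The inequalities between the [K]'s and the multiples of [d] are affine in
    [d], and [d >= b - a].  When [p >= 0] the coefficient of [d] has the
    favourable sign, so the worst case is [d = b - a], where each inequality
    says on which side of its tangent at [b] the graph of [t |-> t `^ p] lies.
    When [p < 0] the bound [K_lt1 <= M_lt0] is a sum of two inequalities:
    [B * d <= a `^ p / b * d], which is [b `^ p <= a `^ p], and
    [a * (A - B) <= (1 - p) * (a `^ p / b) * d], which in the worst case
    [d = b - a] is the tangent inequality at [a].

    The tangent inequalities ([powR_le_tangent], [powR_ge_tangent]) are in turn
    instances of the weighted arithmetic-geometric mean inequality. *)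

(** At a positive base, [mulr_powRB1] holds for exponents of any sign. *)
Lemma mulr_powRB1_gt0 (R : realType) (u p : R) :
  0 < u -> u * u `^ (p - 1) = u `^ p.
Proof.
move=> u0; rewrite -{1}[u]powRr1 ?ltW// -powRD.
  by rewrite addrC subrK.
by rewrite (gt_eqF u0) implybT.
Qed.

Lemma ler_powR_npos (R : realType) (u v q : R) :
  0 < u -> u <= v -> q <= 0 -> v `^ q <= u `^ q.
Proof.
move=> u0 uv q0; have v0 := lt_le_trans u0 uv.
rewrite -[q]opprK !(powRN _ (- q)) lef_pV2 ?posrE ?powR_gt0//.
by apply: ge0_ler_powR; rewrite ?nnegrE ?oppr_ge0// ltW.
Qed.

(** The weighted arithmetic-geometric mean inequality is concavity of [ln],
    exponentiated. *)
Lemma powR_AGM (R : realType) (t u v : R) :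
  0 <= t -> t <= 1 -> 0 < u -> 0 < v ->
  u `^ t * v `^ (1 - t) <= t * u + (1 - t) * v.
Proof.
move=> t0 t1 u0 v0.
have := @concave_ln R (Itv01 t0 t1) u v u0 v0.
rewrite !convRE /= => H.
have m0 : 0 < t * u + (1 - t) * v.
  have [->|tn0] := eqVneq t 0; first by rewrite mul0r add0r subr0 mul1r.
  rewrite ltr_wpDr ?mulr_ge0 ?subr_ge0 ?(ltW v0)//.
  by rewrite mulr_gt0// lt_def tn0.
rewrite -ler_ln ?posrE ?mulr_gt0 ?powR_gt0//.
by rewrite lnM ?posrE ?powR_gt0// !ln_powR.
Qed.

(** The mean inequality with weight [p] bounds [u `^ p * v `^ (1 - p)]; dividing
    by [v `^ (1 - p)] gives the tangent. *)
Lemma powR_le_tangent (R : realType) (p u v : R) :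
  0 <= p -> p <= 1 -> 0 < u -> 0 < v ->
  u `^ p <= v `^ p + p * v `^ (p - 1) * (u - v).
Proof.
move=> p0 p1 u0 v0; have V0 := powR_gt0 (p - 1) v0.
have E : v `^ (1 - p) * v `^ (p - 1) = 1.
  rewrite -powRD ?(gt_eqF v0) ?implybT//.
  by rewrite [1 - p + _](_ : _ = 0) ?powRr0//; ring.
have := powR_AGM p0 p1 u0 v0.
rewrite -(ler_pM2r V0) -[leLHS]mulrA E mulr1 -(mulr_powRB1_gt0 p v0) => H.
by apply: (le_trans H); lra.
Qed.

(** For [1 <= p], the mean inequality with weight [p^-1] is applied to [u `^ p]
    and [v `^ p], which bounds [u * v `^ (p - 1)].  For [p <= 0], it is applied
    with weight [(1 - p)^-1] to [u `^ p] and [u * v `^ (p - 1)], whose weighted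
    geometric mean is [v `^ p].  In both cases multiplying by the inverse of
    the weight gives the tangent. *)
Lemma powR_ge_tangent (R : realType) (p u v : R) :
  (p <= 0) || (1 <= p) -> 0 < u -> 0 < v ->
  v `^ p + p * v `^ (p - 1) * (u - v) <= u `^ p.
Proof.
move=> hp u0 v0; have U0 := powR_gt0 p u0; have V0 := powR_gt0 (p - 1) v0.
case/orP: hp => hp.
  have s0 : 0 < 1 - p by lra.
  have t0 : 0 <= (1 - p)^-1 by rewrite invr_ge0 ltW.
  have t1 : (1 - p)^-1 <= 1 by rewrite invf_le1//; lra.
  have := powR_AGM t0 t1 U0 (mulr_gt0 u0 V0).
  rewrite powRM ?(ltW u0) ?(ltW V0)// mulrA -!powRrM -powRD; last first.
    by rewrite (gt_eqF u0) implybT.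
  have -> : p * (1 - p)^-1 + (1 - (1 - p)^-1) = 0.
    by field; rewrite gt_eqF.
  have -> : (p - 1) * (1 - (1 - p)^-1) = p by field; rewrite gt_eqF.
  rewrite powRr0 mul1r -(ler_pM2l s0) => H.
  have E : (1 - p) * ((1 - p)^-1 * u `^ p
      + (1 - (1 - p)^-1) * (u * v `^ (p - 1))) =
      u `^ p - p * (u * v `^ (p - 1)) by field; rewrite gt_eqF.
  rewrite E -(mulr_powRB1_gt0 p v0) in H.
  rewrite -(mulr_powRB1_gt0 p v0); lra.
have p0 : 0 < p by lra.
have t0 : 0 <= p^-1 by rewrite invr_ge0 ltW.
have t1 : p^-1 <= 1 by rewrite invf_le1.
have := powR_AGM t0 t1 U0 (powR_gt0 p v0).
rewrite -!powRrM divff ?gt_eqF// (powRr1 (ltW u0)).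
have -> : p * (1 - p^-1) = p - 1 by field; rewrite gt_eqF.
rewrite -(ler_pM2l p0) => H.
have E : p * (p^-1 * u `^ p + (1 - p^-1) * v `^ p) =
    u `^ p + (p - 1) * v `^ p by field; rewrite gt_eqF.
rewrite E -(mulr_powRB1_gt0 p v0) in H.
rewrite -(mulr_powRB1_gt0 p v0); lra.
Qed.

(** Both bounds come from [s *: x - t *: y = s *: (x - y) + (s - t) *: y], by
    the triangle inequality. *)
Lemma norm_scaleB_le (R : realType) (X : normedModType R) (s t : R) (x y : X) :
  0 <= s -> `|s *: x - t *: y| <= s * `|x - y| + `|s - t| * `|y|.
Proof.
move=> s0; have -> : s *: x - t *: y = s *: (x - y) + (s - t) *: y.
  by rewrite scalerBr scalerBl addrA subrK.
by apply: le_trans (ler_normD _ _) _; rewrite !normrZ ger0_norm.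
Qed.

Lemma norm_scaleB_ge (R : realType) (X : normedModType R) (s t : R) (x y : X) :
  0 <= s -> s * `|x - y| - `|s - t| * `|y| <= `|s *: x - t *: y|.
Proof.
move=> s0; have -> : s *: x - t *: y = s *: (x - y) + (s - t) *: y.
  by rewrite scalerBr scalerBl addrA subrK.
rewrite -[s in s * _]ger0_norm// -!normrZ.
exact: lerB_normD.
Qed.

Theorem theorem3 (R : realType) (X : normedModType R) (x y : X)
    (hx : x != 0) (hy : y != 0) (p : R) :
  [/\ 1 <= p -> alpha p x y <= K_ge1 x y p /\ K_ge1 x y p <= M_ge1 x y p,
      0 <= p -> p < 1 ->
        alpha p x y <= K_lt1 x y p /\ K_lt1 x y p <= M_01 x y p,
      p < 0 -> alpha p x y <= K_lt1 x y p /\ K_lt1 x y p <= M_lt0 x y p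
    & 0 <= p -> p < 1 ->
        m_01 x y p <= k_lt1 x y p /\ k_lt1 x y p <= alpha p x y].
Proof.
rewrite /k_lt1 /K_lt1 /K_ge1 /m_01 /M_01 /M_ge1 /M_lt0 /alpha.
rewrite /min_norm /max_norm.
wlog xy : x y hx hy / `|x| <= `|y|.
  move=> H; case/orP: (le_total `|x| `|y|); first exact: H.
  move=> /(H y x hy hx); rewrite minC maxC (distrC y x).
  by rewrite [`|y| `^ p + _]addrC [`|y| + _]addrC [`|_ *: y - _|]distrC.
rewrite (min_l xy) (max_r xy).
have a0 : 0 < `|x| by rewrite normr_gt0.
have b0 : 0 < `|y| by rewrite normr_gt0.
have A0 := powR_gt0 (p - 1) a0; have B0 := powR_gt0 (p - 1) b0.
have dab : `|y| - `|x| <= `|x - y| by rewrite distrC lerB_dist.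
have le_y := norm_scaleB_le (`|y| `^ (p - 1)) x y (ltW A0).
have ge_y := norm_scaleB_ge (`|y| `^ (p - 1)) x y (ltW A0).
(* In [K_lt1] the norm [`|x - y|] is multiplied by the power of the larger norm
   [`|y|], hence the exchange of [x] and [y]. *)
have le_x := norm_scaleB_le (`|x| `^ (p - 1)) y x (ltW B0).
rewrite distrC (distrC y) in le_x.
have tang_le p0 p1 := @powR_le_tangent _ p _ _ p0 p1 a0 b0.
have tang_b hp := @powR_ge_tangent _ p _ _ hp a0 b0.
have tang_a hp := @powR_ge_tangent _ p _ _ hp b0 a0.
have mono_np : p < 1 -> `|y| `^ (p - 1) <= `|x| `^ (p - 1).
  by move=> p1; apply: ler_powR_npos => //; lra.
have mono_p : 1 <= p -> `|x| `^ (p - 1) <= `|y| `^ (p - 1).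
  by move=> p1; apply: ge0_ler_powR; rewrite ?nnegrE ?(ltW a0) ?(ltW b0) ?subr_ge0.
have mono_lt0 : p < 0 -> `|y| `^ p <= `|x| `^ p.
  by move=> p0; apply: ler_powR_npos => //; lra.
move: le_y ge_y le_x tang_le tang_b tang_a mono_np mono_p mono_lt0 dab.
rewrite -!(mulr_powRB1_gt0 p a0) -!(mulr_powRB1_gt0 p b0).
(* What is left is elementary algebra in the real numbers [a], [b], [A], [B],
   [d] and the value [al] of [alpha]. *)
move: A0 B0 (`|_ *: x - _|).
move: (`|x| `^ (p - 1)) (`|y| `^ (p - 1)) (`|x - y|) => A B d.
move: a0 b0 xy; move: `|x| `|y| => a b a0 b0 ab A0 B0 al.
move=> le_y ge_y le_x tang_le tang_b tang_a mono_np mono_p mono_lt0 dab.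
have db0 : 0 <= d - (b - a) by lra.
split.
- move=> p1; have AB := mono_p p1.
  have := tang_b _; rewrite p1 orbT => /(_ isT) tg.
  rewrite distrC ger0_norm ?subr_ge0// in le_y.
  split; first lra.
  (* [c0] is the coefficient of [d] in the difference of the two sides. *)
  have c0 : 0 <= p * B - A by nra.
  have := mulr_ge0 c0 db0; lra.
- move=> p0 p1; have BA := mono_np p1; have tg := tang_le p0 (ltW p1).
  rewrite distrC ger0_norm ?subr_ge0// in le_x.
  split; first lra.
  have c0 : 0 <= (1 - p) * B by apply: mulr_ge0; lra.
  have := mulr_ge0 c0 db0; lra.
- move=> p0; have p1 : p < 1 by lra.
  have BA := mono_np p1; have bBaA := mono_lt0 p0.
  have := tang_a _; rewrite (ltW p0) => /(_ isT) tg.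
  rewrite distrC ger0_norm ?subr_ge0// in le_x.
  split; first lra.
  (* The inequality times [b]: [h1] lowers [d] to [b - a] in the part of weight
     [1 - p], [h2] is [b `^ p <= a `^ p], and [h3] the tangent at [a]. *)
  rewrite -(ler_pM2l b0).
  have -> : b * ((2 - p) * (a * A / b) * d) = (2 - p) * (a * A) * d.
    by field; rewrite gt_eqF.
  have d0 : 0 <= d by lra.
  have c0 : 0 <= (1 - p) * (a * A) by apply: mulr_ge0; nra.
  have h1 := mulr_ge0 c0 db0.
  have h2 : 0 <= (a * A - b * B) * d by apply: mulr_ge0 => //; lra.
  have h3 : 0 <= a * (b * B - (a * A + p * A * (b - a))).
    by apply: mulr_ge0; lra.
  lra.
- move=> p0 p1; have BA := mono_np p1; have tg := tang_le p0 (ltW p1).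
  rewrite ger0_norm ?subr_ge0// in ge_y.
  split; last lra.
  have c0 : 0 <= A - p * B by nra.
  have := mulr_ge0 c0 db0; lra.
Qed.
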